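(* Let $(\mathcal G,p)$ be an infinitesimally SA rigid framework in $\mathbb R^2$ and let $\mathcal V=\mathcal V_A\cup\mathcal V_D$ be a given bipartition. If the SA index set $\mathcal T_A$ is connected over $\mathcal G$, then $(\mathcal G(A,D),p)$ is globally SA-RoD rigid.
   Context: $\mathcal{G}=(\mathcal V,\mathcal E)$ is a finite simple undirected graph, $\mathcal V=\{1,\dots,n\}$, $n\ge 3$. A bipartition is $\mathcal V=\mathcal V_A\cup\mathcal V_D$ with $\mathcal V_A,\mathcal V_D$ disjoint and nonempty; $\mathcal G(A,D)$ is $\mathcal G$ with this bipartition, and $\mathcal K(A,D)$ is the complete graph on $\mathcal V$ with the same bipartition. Configurations are $p=(p_1^\top,\dots,p_n^\top)^\top\in\mathbb R^{2n}$; the points $p_i\in\mathbb R^2$ of a framework are pairwise distinct. $e_{ij}=p_j-p_i$, $b_{ij}=e_{ij}/\|e_{ij}\|$, $\mathcal R(\theta)$ is the counter-clockwise rotation matrix. $\mathcal T_{\mathcal G}=\{(u,v,w)\in\mathcal V^3:(u,v),(u,w)\in\mathcal E,v<w\}$; $\mathcal T_A$ (resp. $\mathcal T_D$) is the set of $(u,v,w)\in\mathcal T_{\mathcal G}$ with $u\in\mathcal V_A$ (resp. $u\in\mathcal V_D$). $\alpha_{ijk}\in[0,2\pi)$ (SA) is the signed angle from $b_{ij}$ to $b_{ik}$ counter-clockwise; $\kappa_{ijk}=\|p_k-p_i\|/\|p_j-p_i\|$ (RoD). $f_{\mathcal G(A,D)}(p)=(\ldots,\alpha_{rst},\ldots,\kappa_{ijk},\ldots)^\top$,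 $(r,s,t)\in\mathcal T_A,(i,j,k)\in\mathcal T_D$, defined at every configuration in which adjacent vertices are distinct; likewise $f_{\mathcal K(A,D)}$. The framework is globally SA-RoD rigid if $f^{-1}_{\mathcal{G}(A,D)}(f_{\mathcal{G}(A,D)}(p))=f^{-1}_{\mathcal{K}(A,D)}(f_{\mathcal{K}(A,D)}(p))$. $(\mathcal G,p)$ is infinitesimally SA rigid if every $\delta p\in\mathbb R^{2n}$ annihilated by the derivatives at $p$ of all $\alpha_{rst}$, $(r,s,t)\in\mathcal T_{\mathcal G}$, i.e. satisfying $\frac{b_{rs}^\top\mathcal R(\pi/2)}{\|e_{rs}\|}(\delta p_s-\delta p_r)-\frac{b_{rt}^\top\mathcal R(\pi/2)}{\|e_{rt}\|}(\delta p_t-\delta p_r)=0$, lies in the span of $\mathbf 1_n\otimes(1,0)^\top$, $\mathbf 1_n\otimes(0,1)^\top$, $(I_n\otimes\mathcal R(\pi/2))p$, $p$ (translations, rotation, scaling). $\mathcal T_A$ is connected over $\mathcal G$ if the following triplet index graph is connected: its vertices are the edges of $\mathcal G$, and two edges $\{i,j\},\{i,k\}$ of $\mathcal G$ ($j\ne k$) are adjacent iff $(i,j,k)\in\mathcal T_A$ or $(i,k,j)\in\mathcal T_A$. *)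

(* Defs.v *)
From mathcomp Require Import all_boot all_order all_algebra.
From mathcomp Require Import boolp classical_sets reals topology normedtype.
From mathcomp Require Import trigo.
From mathcomp Require Import ring lra.

Set Implicit Arguments.
Unset Strict Implicit.
Unset Printing Implicit Defensive.
Import Order.TTheory GRing.Theory Num.Theory.
Local Open Scope ring_scope.

Section Plane.
Variable R : realType.

(* The library norm [`|v|] on matrices is the sup norm, hence this one. *)
Definition enorm (v : 'cV[R]_2) : R := Num.sqrt ((v^T *m v) 0 0).

Definition rotation (a : R) : 'M[R]_2 :=
  \matrix_(i, j) if i == j then cos a
                 else if (i : nat) == 0%N then - sin a else sin a.

(* Only meaningful for unit vectors [u] and [w], in which case such an angle
   exists and is unique: see [signed_angleP] and [signed_angle_uniq]. *)
Definition signed_angle (u w : 'cV[R]_2) : R :=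
  xget 0 [set a : R | 0 <= a < pi *+ 2 /\ rotation a *m u = w]%classic.

End Plane.

Section Graphs.
Variables (n : nat) (e : rel 'I_n).

Definition complete_graph : rel 'I_n := fun i j => i != j.

Definition bipartition (VA VD : {set 'I_n}) : Prop :=
  [/\ VA != finset.set0, VD != finset.set0, [disjoint VA & VD]
    & (VA :|: VD)%SET = [set: 'I_n]%SET].

(* [(u, v, w)] is a triplet with apex [u]. *)
Definition triplets : {set 'I_n * 'I_n * 'I_n} :=
  [set t | [&& e t.1.1 t.1.2, e t.1.1 t.2 & (t.1.2 < t.2)%N]]%SET.

Definition triplets_at (V : {set 'I_n}) : {set 'I_n * 'I_n * 'I_n} :=
  [set t in triplets | t.1.1 \in V]%SET.

Definition edges : {set {set 'I_n}} :=
  [set [set x.1; x.2] | x : 'I_n * 'I_n & e x.1 x.2]%SET.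

Definition triplet_adj (T : {set 'I_n * 'I_n * 'I_n}) : rel {set 'I_n} :=
  fun E F => [exists i, exists j, exists k,
    [&& j != k, e i j, e i k, E == [set i; j]%SET, F == [set i; k]%SET
      & ((i, j, k) \in T) || ((i, k, j) \in T)]].

Definition triplets_connected (T : {set 'I_n * 'I_n * 'I_n}) : Prop :=
  {in edges &, forall E F, connect (triplet_adj T) E F}.

End Graphs.

Section Frameworks.
Variables (R : realType) (n : nat).

(* [R^(2n)], with [p i] the [i]-th block of two coordinates. *)
Definition configuration : Type := 'I_n -> 'cV[R]_2.

Implicit Types (p q dp : configuration) (e : rel 'I_n).

Definition edge_vec p (i j : 'I_n) : 'cV[R]_2 := p j - p i.

Definition bearing p (i j : 'I_n) : 'cV[R]_2 :=
  (enorm (edge_vec p i j))^-1 *: edge_vec p i j.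

Definition SA p (t : 'I_n * 'I_n * 'I_n) : R :=
  signed_angle (bearing p t.1.1 t.1.2) (bearing p t.1.1 t.2).

Definition RoD p (t : 'I_n * 'I_n * 'I_n) : R :=
  enorm (edge_vec p t.1.1 t.2) / enorm (edge_vec p t.1.1 t.1.2).

Definition SA_RoD_domain e : set configuration :=
  [set q | forall i j, e i j -> q i <> q j]%classic.

(* The SA-RoD function; its values outside [SA_RoD_domain e] are junk. *)
Definition SA_RoD e (VA VD : {set 'I_n}) q :
    'cV[R]_(#|triplets_at e VA| + #|triplets_at e VD|) :=
  col_mx (\col_(i < #|triplets_at e VA|) SA q (enum_val i))
         (\col_(i < #|triplets_at e VD|) RoD q (enum_val i)).

Definition SA_RoD_fiber e (VA VD : {set 'I_n}) p : set configuration :=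
  [set q | SA_RoD_domain e q /\ SA_RoD e VA VD q = SA_RoD e VA VD p]%classic.

Definition globally_SA_RoD_rigid e (VA VD : {set 'I_n}) p : Prop :=
  SA_RoD_fiber e VA VD p = SA_RoD_fiber (@complete_graph n) VA VD p.

(* [SA_differential p (r, s, t) dp] is the derivative at [p], in the direction
   [dp], of the signed angle from [bearing p r s] to [bearing p r t], taken
   modulo [2 pi] (so that it makes sense also where [SA] jumps from [2 pi]
   to [0]). *)
Definition bearing_angle_differential p dp (i j : 'I_n) : 'M[R]_1 :=
  ((enorm (edge_vec p i j))^-1 *: ((bearing p i j)^T *m rotation (pi / 2)))
    *m (dp j - dp i).

Definition SA_differential p (t : 'I_n * 'I_n * 'I_n) dp : 'M[R]_1 :=
  bearing_angle_differential p dp t.1.1 t.1.2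
  - bearing_angle_differential p dp t.1.1 t.2.

Definition trivial_motion p dp : Prop :=
  exists a b c d : R, forall i,
    dp i = a *: delta_mx 0 0 + b *: delta_mx 1 0
           + c *: (rotation (pi / 2) *m p i) + d *: p i.

Definition infinitesimally_SA_rigid e p : Prop :=
  forall dp, (forall t, t \in triplets e -> SA_differential p t dp = 0) ->
    trivial_motion p dp.

End Frameworks.

Section SignedAngleFacts.
Variable R : realType.
Implicit Types (u w : 'cV[R]_2) (a b c s : R).

Lemma enormE u : enorm u = Num.sqrt (u 0 0 ^+ 2 + u 1 0 ^+ 2).
Proof.
by rewrite /enorm mxE !big_ord_recl big_ord0 addr0 !mxE -!expr2;
  congr (Num.sqrt (_ + u _ _ ^+ 2)); apply: val_inj.
Qed.

Lemma rotationP a u w : rotation a *m u = w <->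
  cos a * u 0 0 - sin a * u 1 0 = w 0 0 /\
  sin a * u 0 0 + cos a * u 1 0 = w 1 0.
Proof.
have E i : (rotation a *m u) i 0 =
    (if i == 0 then cos a else sin a) * u 0 0
    + (if i == 0 then - sin a else cos a) * u 1 0.
  rewrite mxE !big_ord_recl big_ord0 addr0 !mxE.
  have -> : lift ord0 ord0 = 1 :> 'I_2 by apply: val_inj.
  by case: i => -[|[|//]] hi.
split=> [<-|[h0 h1]]; first by rewrite !E /= mulNr.
apply/matrixP => i j; rewrite ord1 E.
case: i => -[|[|//]] hi /=.
  rewrite mulNr h0; congr (w _ _); exact: val_inj.
rewrite h1; congr (w _ _); exact: val_inj.
Qed.

Lemma polar_exists c s : c ^+ 2 + s ^+ 2 = 1 ->
  exists a, [/\ 0 <= a < pi *+ 2, cos a = c & sin a = s].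
Proof.
move=> h; have c1 : -1 <= c <= 1 by apply/andP; split; nra.
have sE : 1 - c ^+ 2 = s ^+ 2 by rewrite -h addrC addKr.
have pi0 := pi_gt0 R.
have [s0|s0] := leP 0 s.
  exists (acos c); split.
  - by have := acos_ge0 c1; have := acos_lepi c1; lra.
  - exact: acosK.
  - by rewrite sin_acos // sE sqrtr_sqr ger0_norm.
exists (pi *+ 2 - acos c); split.
- have a0 : 0 < acos c by apply: acos_gt0; apply/andP; split; nra.
  by have := acos_lepi c1; lra.
- by rewrite cosB cos2pi sin2pi mul1r mul0r addr0 acosK.
- rewrite sinB cos2pi sin2pi mul0r mul1r sub0r sin_acos // sE sqrtr_sqr.
  by rewrite ltr0_norm // opprK.
Qed.

Lemma polar_uniq a b : 0 <= a < pi *+ 2 -> 0 <= b < pi *+ 2 ->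
  cos a = cos b -> sin a = sin b -> a = b.
Proof.
wlog ab : a b / a <= b.
  move=> W ha hb hc hs; have [/W|/ltW/W] := leP a b; first exact.
  by move=> /(_ hb ha) ->.
move=> ha hb hc hs; apply/eqP; rewrite eq_le ab /= leNgt; apply/negP => lt_ab.
have s0 : 0 < sin ((b - a) / 2) by apply: sin_gt0_pi; apply/andP; split; lra.
have : cos (b - a) = 1 by rewrite cosB hc hs -!expr2 cos2Dsin2.
have -> : b - a = (b - a) / 2 *+ 2 by lra.
have := cos2Dsin2 ((b - a) / 2).
rewrite cos_mulr2n; nra.
Qed.

Lemma signed_angleP u w : enorm u = 1 -> enorm w = 1 ->
  0 <= signed_angle u w < pi *+ 2 /\ rotation (signed_angle u w) *m u = w.
Proof.
rewrite !enormE => hu hw; rewrite /signed_angle.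
have sq x y : Num.sqrt (x ^+ 2 + y ^+ 2) = 1 -> x ^+ 2 + y ^+ 2 = 1 :> R.
  move=> /(congr1 (fun z => z ^+ 2)).
  by rewrite sqr_sqrtr ?expr1n // addr_ge0 ?sqr_ge0.
move: hu hw => /sq hu /sq hw.
have [|a [ha hc hs]] := @polar_exists
    (u 0 0 * w 0 0 + u 1 0 * w 1 0) (u 0 0 * w 1 0 - u 1 0 * w 0 0).
  rewrite -[RHS]mulr1 -{1}hu -hw; ring.
pose P := [set a : R | 0 <= a < pi *+ 2 /\ rotation a *m u = w]%classic.
apply: (@xgetI _ 0 P a); split; first exact: ha.
apply/rotationP; rewrite hc hs; split.
  rewrite -[RHS]mul1r -hu; ring.
rewrite -[RHS]mul1r -hu; ring.
Qed.

Lemma signed_angle_uniq u a b : enorm u = 1 ->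
  0 <= a < pi *+ 2 -> 0 <= b < pi *+ 2 ->
  rotation a *m u = rotation b *m u -> a = b.
Proof.
rewrite enormE => hu ha hb /rotationP.
have /rotationP [<- <-] := erefl (rotation b *m u) => -[h0 h1].
have {}hu : u 0 0 ^+ 2 + u 1 0 ^+ 2 = 1.
  rewrite -(sqr_sqrtr (addr_ge0 (sqr_ge0 (u 0 0)) (sqr_ge0 (u 1 0)))) hu.
  by rewrite expr1n.
apply: polar_uniq => //.
  have E c s x y :
    c * (x ^+ 2 + y ^+ 2) = x * (c * x - s * y) + y * (s * x + c * y) by ring.
  by rewrite -[LHS]mulr1 -[RHS]mulr1 -hu (E _ (sin a)) (E _ (sin b)) h0 h1.
have E c s x y :
  s * (x ^+ 2 + y ^+ 2) = x * (s * x + c * y) - y * (c * x - s * y) by ring.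
by rewrite -[LHS]mulr1 -[RHS]mulr1 -hu (E (cos a)) (E (cos b)) h0 h1.
Qed.

End SignedAngleFacts.

(* Main.v *)
(** The bearings of two configurations with the same signed angles at [(i, j, k)]
    differ on [ij] and on [ik] by the same rotation, and the bearings of [ij] and
    [ji] are always rotated alike.  Connectedness of [T_A] therefore makes every
    edge of [q] a positive multiple of one fixed rotation of the same edge of [p].
    Undoing this rotation turns [q] into a motion of [p] that stretches each edge
    along itself; such a motion leaves all signed angles stationary, so it is
    trivial by infinitesimal rigidity.  Hence [q] is the image of [p] under an
    orientation-preserving similarity, which preserves all angles and ratios. *)
Require Import Defs.
From mathcomp Require Import all_boot all_order all_algebra reals.
From mathcomp Require Import boolp classical_sets trigo ring.

Set Implicit Arguments.
Unset Strict Implicit.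
Unset Printing Implicit Defensive.
Import Order.TTheory GRing.Theory Num.Theory.
Local Open Scope ring_scope.

(** * Rotations, the Euclidean norm and signed angles in the plane *)

Section Plane.
Variable R : realType.
Implicit Types (u v w : 'cV[R]_2) (a b k : R).

Lemma colvec2P u w : u 0 0 = w 0 0 -> u 1 0 = w 1 0 -> u = w.
Proof.
move=> h0 h1; apply/matrixP => i j; rewrite ord1.
by case: i => -[|[|//]] hi; [move: h0 | move: h1];
  congr (u _ _ = w _ _); apply: val_inj.
Qed.

Lemma rotation_mulE0 a u : (rotation a *m u) 0 0 = cos a * u 0 0 - sin a * u 1 0.
Proof. by have /rotationP [<-] := erefl (rotation a *m u). Qed.

Lemma rotation_mulE1 a u : (rotation a *m u) 1 0 = sin a * u 0 0 + cos a * u 1 0.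
Proof. by have /rotationP [_ <-] := erefl (rotation a *m u). Qed.

Lemma rotation_comm a b u :
  rotation a *m (rotation b *m u) = rotation b *m (rotation a *m u).
Proof.
by apply: colvec2P; rewrite !(rotation_mulE0, rotation_mulE1); ring.
Qed.

Lemma rotationNK a u : rotation (- a) *m (rotation a *m u) = u.
Proof.
have h := cos2Dsin2 a.
apply: colvec2P; rewrite !(rotation_mulE0, rotation_mulE1) cosN sinN.
- by rewrite -[RHS]mul1r -h; ring.
- by rewrite -[RHS]mul1r -h; ring.
Qed.

Lemma rotationKN a u : rotation a *m (rotation (- a) *m u) = u.
Proof. by rewrite rotation_comm rotationNK. Qed.

Lemma rotation_inj a : injective (fun u => rotation a *m u).
Proof. exact: can_inj (rotationNK a). Qed.

Lemma quarter_turn_orthogonal u : u^T *m rotation (pi / 2) *m u = 0.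
Proof.
rewrite -mulmxA; apply/matrixP => i j; rewrite !ord1 !mxE.
rewrite !big_ord_recl big_ord0 addr0.
have -> : lift ord0 ord0 = 1 :> 'I_2 by apply: val_inj.
rewrite rotation_mulE0 rotation_mulE1 !mxE cos_pihalf sin_pihalf; ring.
Qed.

Lemma enorm_rotation a u : enorm (rotation a *m u) = enorm u.
Proof.
rewrite !enormE rotation_mulE0 rotation_mulE1; congr Num.sqrt.
by rewrite -[RHS]mul1r -(cos2Dsin2 a); ring.
Qed.

Lemma enormZ k u : 0 <= k -> enorm (k *: u) = k * enorm u.
Proof.
move=> k0; rewrite !enormE !mxE !exprMn -mulrDr sqrtrM ?sqr_ge0 //.
by rewrite sqrtr_sqr ger0_norm.
Qed.

Lemma enormN u : enorm (- u) = enorm u.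
Proof. by rewrite !enormE !mxE !sqrrN. Qed.

Lemma enorm_gt0 u : u != 0 -> 0 < enorm u.
Proof.
move=> u0; rewrite enormE sqrtr_gt0 lt0r addr_ge0 ?sqr_ge0 // andbT.
apply: contra u0; rewrite paddr_eq0 ?sqr_ge0 // !sqrf_eq0 => /andP[/eqP h0 /eqP h1].
by apply/eqP/colvec2P; rewrite mxE.
Qed.

(** Plane rotations commute and are injective, so both sides select from the same set of angles; [u]
    and [w] need not be unit vectors. *)
Lemma signed_angle_rotation a u w :
  signed_angle (rotation a *m u) (rotation a *m w) = signed_angle u w.
Proof.
rewrite /signed_angle; congr xget; apply/seteqP; split=> b /= -[hb h]; split=> //.
  by apply: (@rotation_inj a); rewrite -h rotation_comm.
by rewrite rotation_comm h.
Qed.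

(* Over C: if the real [k] satisfies [k u = (d + i c) u], then [d + i c = k]. *)
Lemma real_similarity u k c d : u != 0 ->
  k *: u = c *: (rotation (pi / 2) *m u) + d *: u -> c = 0 /\ d = k.
Proof.
have := rotation_mulE1 (pi / 2) u; have := rotation_mulE0 (pi / 2) u.
rewrite cos_pihalf sin_pihalf; move: (_ *m u) => v v0 v1 u0 h.
have := congr1 (fun w : 'cV[R]_2 => w 1 0) h.
have := congr1 (fun w : 'cV[R]_2 => w 0 0) h.
rewrite !mxE v0 v1 => h0 h1.
have N : u 0 0 ^+ 2 + u 1 0 ^+ 2 != 0.
  by apply/eqP => N; have := enorm_gt0 u0; rewrite enormE N sqrtr0 ltxx.
split; apply: (mulIf N).
  (* The inner products of the right-hand side of [h] with the quarter turn of [u] and with [u]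
     isolate [c] and [d], each times the squared norm of [u]. *)
  have -> : c * (u 0 0 ^+ 2 + u 1 0 ^+ 2) =
    u 0 0 * (c * (1 * u 0 0 + 0 * u 1 0) + d * u 1 0)
    - u 1 0 * (c * (0 * u 0 0 - 1 * u 1 0) + d * u 0 0) by ring.
  by rewrite -h0 -h1; ring.
have -> : d * (u 0 0 ^+ 2 + u 1 0 ^+ 2) =
  u 1 0 * (c * (1 * u 0 0 + 0 * u 1 0) + d * u 1 0)
  + u 0 0 * (c * (0 * u 0 0 - 1 * u 1 0) + d * u 0 0) by ring.
by rewrite -h0 -h1; ring.
Qed.

End Plane.

(** * Bearings of a framework and their common rotation *)

Section Frameworks.
Variables (R : realType) (n : nat).
Implicit Types (p q dp : configuration R n) (e : rel 'I_n).

Lemma enorm_edge_gt0 p i j : p i <> p j -> 0 < enorm (edge_vec p i j).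
Proof. by move=> h; apply: enorm_gt0; rewrite subr_eq0; apply/eqP => /esym. Qed.

Lemma enorm_bearing p i j : p i <> p j -> enorm (bearing p i j) = 1.
Proof.
move=> /enorm_edge_gt0 h.
by rewrite enormZ ?invr_ge0 ?(ltW h) // mulVf // gt_eqF.
Qed.

Lemma edge_vecE p i j : p i <> p j ->
  edge_vec p i j = enorm (edge_vec p i j) *: bearing p i j.
Proof.
by move=> /enorm_edge_gt0 h; rewrite scalerA divff ?scale1r // gt_eqF.
Qed.

Lemma bearingC p i j : bearing p j i = - bearing p i j.
Proof. by rewrite /bearing /edge_vec -opprB enormN scalerN. Qed.

Lemma SA_rotation p i j k : p i <> p j -> p i <> p k ->
  rotation (SA p (i, j, k)) *m bearing p i j = bearing p i k.
Proof.
by move=> hj hk; have [] := signed_angleP (enorm_bearing hj) (enorm_bearing hk).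
Qed.

Lemma SA_RoD_fiberP e (VA VD : {set 'I_n}) p q :
  SA_RoD_fiber e VA VD p q <->
  [/\ SA_RoD_domain e q, {in triplets_at e VA, SA q =1 SA p}
    & {in triplets_at e VD, RoD q =1 RoD p}].
Proof.
split=> [[dom /eq_col_mx [hA hD]]|[dom hA hD]]; split=> //.
- move=> t tA; have := congr1 (fun v : 'cV[R]_ _ => v (enum_rank_in tA t) 0) hA.
  by rewrite !mxE enum_rankK_in.
- move=> t tD; have := congr1 (fun v : 'cV[R]_ _ => v (enum_rank_in tD t) 0) hD.
  by rewrite !mxE enum_rankK_in.
congr col_mx; apply/matrixP => i j; rewrite !mxE; [apply: hA | apply: hD];
  exact: enum_valP.
Qed.

Lemma same_bearing_rotation e (V : {set 'I_n}) p q :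
  symmetric e -> triplets_connected e (triplets_at e V) ->
  SA_RoD_domain e p -> SA_RoD_domain e q ->
  {in triplets_at e V, SA q =1 SA p} ->
  exists a, forall i j, e i j -> bearing q i j = rotation a *m bearing p i j.
Proof.
move=> e_sym conn domp domq eqSA.
have edge i j : e i j -> [set i; j]%SET \in edges e.
  by move=> eij; apply/imsetP; exists (i, j); rewrite ?inE.
(* The angle is read off at one edge; without edges any angle does. *)
have [[[i0 j0] /= e0]|noedge] := pselect (exists x : 'I_n * 'I_n, e x.1 x.2);
  last by exists 0 => i j eij; case: noedge; exists (i, j).
pose a := signed_angle (bearing p i0 j0) (bearing q i0 j0).
pose turned i j := bearing q i j = rotation a *m bearing p i j.
have turnedC i j : turned i j -> turned j i.
  by rewrite /turned !(bearingC _ i j) mulmxN => ->.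
(* Vertices of the triplet index graph are unordered pairs, so the property must not depend on the
   orientation of the edge. *)
have turned_set i j i' j' :
    [set i; j]%SET = [set i'; j']%SET -> turned i j -> turned i' j'.
  move=> eqS tij.
  have : i' \in [set i; j]%SET by rewrite eqS set21.
  have : j' \in [set i; j]%SET by rewrite eqS set22.
  have : i \in [set i'; j']%SET by rewrite -eqS set21.
  have : j \in [set i'; j']%SET by rewrite -eqS set22.
  rewrite !inE => jS iS /orP[]/eqP jE /orP[]/eqP iE; move: jS iS tij.
  - by rewrite iE jE !orbb => /eqP->.
  - by rewrite iE jE => _ _ /turnedC.
  - by rewrite iE jE.
  - by rewrite iE jE !orbb => _ /eqP->.
have turned_step i j k : e i j -> e i k ->
    (i, j, k) \in triplets_at e V \/ (i, k, j) \in triplets_at e V ->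
    turned i j -> turned i k.
  move=> eij eik [] ht tij; have hS := eqSA _ ht.
    rewrite /turned -(SA_rotation (domq _ _ eij) (domq _ _ eik)) hS tij.
    by rewrite rotation_comm SA_rotation //; apply: domp.
  (* Here the signed angle runs from [ik] to [ij], so its rotation has to be cancelled. *)
  apply: (@rotation_inj _ (SA p (i, k, j))) => /=.
  rewrite rotation_comm (SA_rotation (domp _ _ eik) (domp _ _ eij)) -tij.
  by rewrite -hS SA_rotation //; apply: domq.
pose good (E : {set 'I_n}) := forall i j, E = [set i; j]%SET -> turned i j.
have good_path s E : path (triplet_adj e (triplets_at e V)) E s ->
    good E -> good (last E s).
  elim: s E => //= F s IH E /andP[adj /IH {}IH] gE; apply: IH => i' k' eqF.
  case/existsP: adj => i /existsP[j /existsP[k]].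
  case/and5P=> _ eij eik /eqP hE /andP[/eqP hF /orP ht].
  apply: turned_set (etrans (esym hF) eqF) _.
  exact: turned_step ht (gE _ _ hE).
have good0 : good [set i0; j0]%SET.
  move=> i j /turned_set; apply.
  have [_ h] := signed_angleP (enorm_bearing (domp _ _ e0))
    (enorm_bearing (domq _ _ e0)).
  exact: esym h.
exists a => i j eij.
have /connectP[s /good_path /(_ good0) gs eqs] := conn _ _ (edge _ _ e0) (edge _ _ eij).
exact: gs (esym eqs).
Qed.

(** * Infinitesimal motions and the passage to a similarity *)

Lemma edge_stretch_SA_differential p dp i j k l m :
  dp j - dp i = l *: edge_vec p i j -> dp k - dp i = m *: edge_vec p i k ->
  SA_differential p (i, j, k) dp = 0.
Proof.
(* The direction of an edge reacts only to the component of the relative velocity orthogonal to that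
   edge. *)
have stationary s x : dp s - dp i = x *: edge_vec p i s ->
    bearing_angle_differential p dp i s = 0.
  rewrite /bearing_angle_differential => ->.
  rewrite /bearing -scalemxAr [_^T]linearZ /= -!scalemxAl.
  by rewrite quarter_turn_orthogonal !scaler0.
by move=> /stationary hj /stationary hk; rewrite /SA_differential hj hk subr0.
Qed.

Lemma trivial_motion_sub p dp : trivial_motion p dp ->
  exists c d, forall i j, dp j - dp i =
    c *: (rotation (pi / 2) *m edge_vec p i j) + d *: edge_vec p i j.
Proof.
move=> [a [b [c [d h]]]]; exists c, d => i j.
rewrite /edge_vec !h mulmxBr !scalerBr; move: (a *: _ + _) => x.
by rewrite opprD addrACA; congr (_ + _); rewrite opprD addrACA subrr add0r.
Qed.

(* Without edges, moving a single vertex would be a trivial motion. *)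
Lemma rigid_has_edge e p : (2 < n)%N -> injective p ->
  infinitesimally_SA_rigid e p -> exists i j, e i j.
Proof.
move=> hn p_inj rig; apply: contrapT => noedge.
pose i0 := Ordinal (ltn_trans (ltn0Sn 1) hn).
pose i1 := Ordinal (ltnW hn); pose i2 := Ordinal hn.
pose dp : configuration R n := fun i => if i == i0 then const_mx 1 else 0.
have /trivial_motion_sub[c [d h]] : trivial_motion p dp.
  apply: rig => -[[i j] k]; rewrite inE /= => /and3P[eij _ _].
  by case: noedge; exists i, j.
have ne i j : i != j -> edge_vec p i j != 0.
  by rewrite subr_eq0; apply: contra => /eqP/p_inj->.
(* The two unmoved vertices [i1] and [i2] force [c = d = 0], so [i0] could not move relative to
   [i1]. *)
have [] := @real_similarity _ (edge_vec p i1 i2) 0 c d (ne i1 i2 isT).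
  by rewrite scale0r -h /dp /= subr0.
move=> c0 d0; have := h i1 i0; rewrite c0 d0 !scale0r addr0 /dp /= subr0.
move=> /(congr1 (fun v : 'cV[R]_2 => v 0 0)); rewrite !mxE => /eqP.
by rewrite oner_eq0.
Qed.

Lemma rigid_similar e p q :
  (2 < n)%N -> injective p -> infinitesimally_SA_rigid e p ->
  SA_RoD_domain e p -> SA_RoD_domain e q ->
  forall a, (forall i j, e i j -> bearing q i j = rotation a *m bearing p i j) ->
  exists2 d, 0 < d &
    forall i j, edge_vec q i j = d *: (rotation a *m edge_vec p i j).
Proof.
move=> hn p_inj rig domp domq a hb.
(* The configuration [q] turned back is itself taken as the velocity, rather than its displacement
   from [p]. *)
pose dp : configuration R n := fun i => rotation (- a) *m q i.
pose k i j := enorm (edge_vec q i j) / enorm (edge_vec p i j).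
have dpE i j : e i j -> dp j - dp i = k i j *: edge_vec p i j.
  move=> eij; rewrite /dp -mulmxBr -/(edge_vec q i j) (edge_vecE (domq _ _ eij)).
  by rewrite hb // -scalemxAr rotationNK /bearing scalerA.
have /trivial_motion_sub[c [d h]] : trivial_motion p dp.
  apply: rig => -[[r s] t]; rewrite inE /= => /and3P[ers ert _].
  exact: edge_stretch_SA_differential (dpE _ _ ers) (dpE _ _ ert).
(* A single edge shows that the rotational part [c] vanishes and that [d] is a ratio of lengths,
   hence positive. *)
have [i [j eij]] := rigid_has_edge hn p_inj rig.
have [||c0 dk] := @real_similarity _ (edge_vec p i j) (k i j) c d.
- by rewrite subr_eq0; apply/eqP => /esym; apply: domp.
- by rewrite -dpE.
exists d; first by rewrite dk divr_gt0 // enorm_edge_gt0 //;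
  [apply: domq | apply: domp].
move=> r s; have := h r s; rewrite c0 scale0r add0r /dp -mulmxBr.
by move=> /(congr1 (mulmx (rotation a))); rewrite rotationKN -scalemxAr.
Qed.

(** All bearings turn by the same [a], and the common factor [d] cancels in ratios of lengths. *)
Lemma similar_SA_RoD p q a d : 0 < d ->
  (forall i j, edge_vec q i j = d *: (rotation a *m edge_vec p i j)) ->
  SA q =1 SA p /\ RoD q =1 RoD p.
Proof.
move=> d0 h; have dn0 : d != 0 by rewrite gt_eqF.
have nE i j : enorm (edge_vec q i j) = d * enorm (edge_vec p i j).
  by rewrite h enormZ ?(ltW d0) // enorm_rotation.
split=> t; last by rewrite /RoD !nE -mulf_div divff // mul1r.
have bE i j : bearing q i j = rotation a *m bearing p i j.
  by rewrite /bearing nE h -scalemxAr scalerA invfM mulrAC mulVf // mul1r.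
by rewrite /SA !bE signed_angle_rotation.
Qed.

End Frameworks.

Theorem theorem4 (R : realType) (n : nat) (hn : (3 <= n)%N)
    (e : rel 'I_n) (e_sym : symmetric e) (e_irr : irreflexive e)
    (p : configuration R n) (p_inj : injective p)
    (p_rigid : infinitesimally_SA_rigid e p)
    (VA VD : {set 'I_n}) (h_bip : bipartition VA VD)
    (h_conn : triplets_connected e (triplets_at e VA)) :
  globally_SA_RoD_rigid e VA VD p.
Proof.
have sub_complete i j : e i j -> complete_graph i j.
  by move=> eij; apply/eqP => ij; rewrite ij e_irr in eij.
have domp : SA_RoD_domain e p.
  by move=> i j /sub_complete/eqP ij /p_inj.
apply/seteqP; split=> q /SA_RoD_fiberP[domq hA hD]; apply/SA_RoD_fiberP.
  have [a hb] := same_bearing_rotation e_sym h_conn domp domq hA.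
  have [d d0 sim] := rigid_similar hn p_inj p_rigid domp domq hb.
  have [eqSA eqRoD] := similar_SA_RoD d0 sim.
  split=> [i j /eqP ij qij|t _|t _]; [|exact: eqSA|exact: eqRoD].
  (* The fiber of the complete graph asks for pairwise distinct points: if [q i = q j], the
     similarity would give [p i = p j]. *)
  apply: ij; apply/p_inj/esym/eqP; rewrite -subr_eq0; apply/eqP.
  apply: (@rotation_inj _ a); rewrite /= mulmx0; apply/eqP.
  have := sim i j; rewrite {1}/edge_vec qij subrr => /esym/eqP.
  by rewrite scaler_eq0 gt_eqF.
(* For the converse inclusion, the complete graph only imposes more constraints. *)
have sub_triplets (V : {set 'I_n}) :
    {subset triplets_at e V <= triplets_at (@complete_graph n) V}.
  move=> t; rewrite !inE => /andP[/and3P[h1 h2 ->] ->].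
  by rewrite !sub_complete.
split=> [i j /sub_complete|t /sub_triplets|t /sub_triplets];
  [exact: domq | exact: hA | exact: hD].
Qed.
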